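(* Let $S$ be an inverse semigroup. Then the classifying space $\mathcal{B}(S)$ of $S$ (the category of left étale actions of $S$) is equivalent to the category $\mathrm{Et}/S$ of right generalized inverse $\ast$-semigroups étale over $S$.
   Context: All semigroups and all sets acted upon are non-empty. For an inverse semigroup $S$, $E(S)$ denotes its semilattice of idempotents and $s^{-1}$ the unique inverse of $s$. For any semigroup $T$, $E(T)$ is its set of idempotents. Left étale actions. A left action of $S$ on a set $X$ is a map $S\times X\to X$, $(s,x)\mapsto s\cdot x$, with $(st)\cdot x=s\cdot(t\cdot x)$. A left étale action $(S,X,p)$ is a left action of $S$ on $X$ together with a function $p\colon X\to E(S)$ such that (E1) $p(x)\cdot x=x$ and (E2) $p(s\cdot x)=s\,p(x)\,s^{-1}$, for all $s\in S$, $x\in X$. A morphism $\varphi\colon (S,X,p)\to(S,Y,q)$ is a map $\varphi\colon X\to Y$ with $q(\varphi(x))=p(x)$ and $\varphi(s\cdot x)=s\cdot\varphi(x)$ for all $s\in S$, $x\in X$. The category of all left étale $S$-actions with these morphisms is the classifying space $\mathcal{B}(S)$ of $S$. Right generalized inverse $\ast$-semigroups. A semigroup is regular if every element $s$ has an inverse, i.e. an element $t$ with $s=sts$, $t=tst$; $V(s)$ is the set of inverses of $s$. A band is a semigroup in which every element is idempotent; a right normal band is a band satisfying $efg=feg$. A right generalized inverse semigroup is a regular semigroup whose idempotents form a right normal band. A (right) $\ast$-semigroup is a semigroup with a unary operation $s\mapsto s^{\ast}$ satisfying (S1) $(s^{\ast})^{\ast}=s$; (S2) $s^{\ast}\in V(s)$;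 (S3) $(st)^{\ast}=t^{\ast}(stt^{\ast})^{\ast}$; (S4) if $e^2=e$ then $e^{\ast}=e$. A right generalized inverse $\ast$-semigroup is a right generalized inverse semigroup equipped with such an operation. A $\ast$-homomorphism is a semigroup homomorphism preserving $\ast$. The category $\mathrm{Et}/S$. Let $T$ be a right generalized inverse $\ast$-semigroup. A semigroup homomorphism $\theta\colon T\to S$ is étale if for each $e\in E(T)$ the restriction $Te\to S\theta(e)$ of $\theta$ is a bijection. The objects of $\mathrm{Et}/S$ are étale homomorphisms $\phi\colon T\to S$ from right generalized inverse $\ast$-semigroups $T$; a morphism from $\phi_1\colon T_1\to S$ to $\phi_2\colon T_2\to S$ is a $\ast$-homomorphism $\theta\colon T_1\to T_2$ with $\phi_2\theta=\phi_1$ (maps composed right to left). *)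

(* Defs.v *)
From HB Require Import structures.
From mathcomp Require Import all_boot.
From mathcomp Require Import boolp classical_sets functions.

Set Implicit Arguments.
Unset Strict Implicit.
Unset Printing Implicit Defensive.

Local Open Scope classical_set_scope.
Local Open Scope group_scope.

Record category := Category {
  obj :> Type;
  hom : obj -> obj -> Type;
  idm : forall a, hom a a;
  comp : forall a b c, hom b c -> hom a b -> hom a c;
  comp1m : forall a b (f : hom a b), comp (idm b) f = f;
  compm1 : forall a b (f : hom a b), comp f (idm a) = f;
  compmA : forall a b c d (h : hom c d) (g : hom b c) (f : hom a b),
    comp h (comp g f) = comp (comp h g) f
}.

Arguments hom {C} a b : rename.
Arguments idm {C} a : rename.
Arguments comp {C a b c} g f : rename.

Record functor (C D : category) := Functor {
  fobj :> C -> D;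
  fmap : forall a b : C, hom a b -> hom (fobj a) (fobj b);
  fmap1 : forall a : C, fmap (idm a) = idm (fobj a);
  fmapM : forall (a b c : C) (g : hom b c) (f : hom a b),
    fmap (comp g f) = comp (fmap g) (fmap f)
}.

Arguments fmap {C D} F {a b} f : rename.

Definition functor_id (C : category) : functor C C :=
  @Functor C C id (fun _ _ f => f) (fun=> erefl) (fun _ _ _ _ _ => erefl).

Section FunctorComp.
Variables (C D E : category) (G : functor D E) (F : functor C D).

Let gfmap (a b : C) (f : hom a b) : hom (G (F a)) (G (F b)) := fmap G (fmap F f).

Fact functor_comp_fmap1 (a : C) : gfmap (idm a) = idm (G (F a)).
Proof. by rewrite /gfmap !fmap1. Qed.

Fact functor_comp_fmapM (a b c : C) (g : hom b c) (f : hom a b) :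
  gfmap (comp g f) = comp (gfmap g) (gfmap f).
Proof. by rewrite /gfmap !fmapM. Qed.

Definition functor_comp : functor C E :=
  Functor functor_comp_fmap1 functor_comp_fmapM.

End FunctorComp.

Definition isomorphism (C : category) (a b : C) (f : hom a b) : Prop :=
  exists g : hom b a, comp g f = idm a /\ comp f g = idm b.

Definition naturally_isomorphic (C D : category) (F G : functor C D) : Prop :=
  exists eta : forall a : C, hom (F a) (G a),
    (forall (a b : C) (f : hom a b),
       comp (eta b) (fmap F f) = comp (fmap G f) (eta a)) /\
    (forall a : C, isomorphism (eta a)).

Definition equivalent_categories (C D : category) : Prop :=
  exists (F : functor C D) (G : functor D C),
    naturally_isomorphic (functor_comp G F) (functor_id C) /\
    naturally_isomorphic (functor_comp F G) (functor_id D).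

(* V(s) *)
Definition inverses (T : semigroupType) (s : T) : set T :=
  [set t | s = s * t * s /\ t = t * s * t].

(* E(T); where a type is expected, the coercion [set_type] makes it the
   subtype of idempotents. *)
Definition idempotents (T : semigroupType) : set T := [set e | e * e = e].
Arguments idempotents : clear implicits.

Definition left_ideal_of (T : semigroupType) (a : T) : set T :=
  range (fun t : T => t * a).

Definition regular (T : semigroupType) : Prop :=
  forall s : T, inverses s !=set0.

Definition right_normal_band (T : semigroupType) (B : set T) : Prop :=
  [/\ forall e f, B e -> B f -> B (e * f),
      forall e, B e -> e * e = e &
      forall e f g, B e -> B f -> B g -> e * f * g = f * e * g].

HB.mixin Record isNonempty T := {
  nonempty : [set: T] !=set0
}.

#[short(type="nonemptySemigroupType")]
HB.structure Definition NonemptySemigroup := {T of Semigroup T & isNonempty T}.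

HB.mixin Record Semigroup_isInverse S of Semigroup S := {
  sinv : S -> S;
  sinv_inverses : forall s : S, inverses s (sinv s);
  sinv_unique : forall s t : S, inverses s t -> t = sinv s
}.

#[short(type="inverseSemigroupType")]
HB.structure Definition InverseSemigroup :=
  {S of NonemptySemigroup S & Semigroup_isInverse S}.

HB.mixin Record Semigroup_isRightGenInverse T of Semigroup T := {
  rgi_regular : regular T;
  rgi_right_normal_band : right_normal_band (idempotents T)
}.

#[short(type="rightGenInverseSemigroupType")]
HB.structure Definition RightGenInverseSemigroup :=
  {T of NonemptySemigroup T & Semigroup_isRightGenInverse T}.

HB.mixin Record Semigroup_isStar T of Semigroup T := {
  star : T -> T;
  starK : forall s : T, star (star s) = s;
  star_inverses : forall s : T, inverses s (star s);
  starM : forall s t : T, star (s * t) = star t * star (s * t * star t);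
  star_idempotent : forall e : T, idempotents T e -> star e = e
}.

#[short(type="rightGenInverseStarSemigroupType")]
HB.structure Definition RightGenInverseStarSemigroup :=
  {T of RightGenInverseSemigroup T & Semigroup_isStar T}.

Record etale_action (S : inverseSemigroupType) := EtaleAction {
  carrier :> Type;
  carrier_nonempty : [set: carrier] !=set0;
  act : S -> carrier -> carrier;
  actM : forall (s t : S) (x : carrier), act (s * t) x = act s (act t x);
  anchor : carrier -> idempotents S;
  act_anchor : forall x : carrier, act (\val (anchor x)) x = x;
  anchor_act : forall (s : S) (x : carrier),
    \val (anchor (act s x)) = s * \val (anchor x) * sinv s
}.

Arguments act {S X} s x : rename.
Arguments anchor {S X} x : rename.

Record etale_action_hom (S : inverseSemigroupType) (X Y : etale_action S) :=
  EtaleActionHom {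
  action_map :> X -> Y;
  anchor_action_map : forall x : X, anchor (action_map x) = anchor x;
  act_action_map : forall (s : S) (x : X),
    action_map (act s x) = act s (action_map x)
}.

Section ClassifyingSpace.
Variable S : inverseSemigroupType.
Implicit Types X Y Z W : etale_action S.

Lemma etale_action_hom_eq X Y (f g : etale_action_hom X Y) : f =1 g -> f = g.
Proof.
case: f g => [f f1 f2] [g g1 g2] /= /funext fg; subst g.
by rewrite (Prop_irrelevance f1 g1) (Prop_irrelevance f2 g2).
Qed.

Definition etale_action_id X : etale_action_hom X X :=
  @EtaleActionHom S X X id (fun=> erefl) (fun _ _ => erefl).

Section Comp.
Variables (X Y Z : etale_action S).
Variables (g : etale_action_hom Y Z) (f : etale_action_hom X Y).

Fact anchor_comp (x : X) : anchor ((g \o f) x) = anchor x.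
Proof. by rewrite /= !anchor_action_map. Qed.

Fact act_comp (s : S) (x : X) : (g \o f) (act s x) = act s ((g \o f) x).
Proof. by rewrite /= !act_action_map. Qed.

Definition etale_action_comp : etale_action_hom X Z :=
  EtaleActionHom anchor_comp act_comp.

End Comp.

Fact etale_action_comp1m X Y (f : etale_action_hom X Y) :
  etale_action_comp (etale_action_id Y) f = f.
Proof. exact: etale_action_hom_eq. Qed.

Fact etale_action_compm1 X Y (f : etale_action_hom X Y) :
  etale_action_comp f (etale_action_id X) = f.
Proof. exact: etale_action_hom_eq. Qed.

Fact etale_action_compmA X Y Z W (h : etale_action_hom Z W)
    (g : etale_action_hom Y Z) (f : etale_action_hom X Y) :
  etale_action_comp h (etale_action_comp g f) =
  etale_action_comp (etale_action_comp h g) f.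
Proof. exact: etale_action_hom_eq. Qed.

Definition classifying_space : category :=
  Category etale_action_comp1m etale_action_compm1 etale_action_compmA.

End ClassifyingSpace.

Definition etale (T S : semigroupType) (theta : {multiplicative T -> S}) : Prop :=
  forall e : T, idempotents T e ->
    set_bij (left_ideal_of e) (left_ideal_of (theta e)) theta.

Record etale_over (S : inverseSemigroupType) := EtaleOver {
  total :> rightGenInverseStarSemigroupType;
  projection : {multiplicative total -> S};
  projection_etale : etale projection
}.

Arguments projection {S} T : rename.

Record etale_over_hom (S : inverseSemigroupType) (T1 T2 : etale_over S) :=
  EtaleOverHom {
  over_map :> {multiplicative T1 -> T2};
  over_map_star : forall t : T1, over_map (star t) = star (over_map t);
  over_map_projection : projection T2 \o over_map =1 projection T1
}.

Section EtaleOver.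
Variable S : inverseSemigroupType.
Implicit Types T : etale_over S.

Lemma etale_over_hom_eq T1 T2 (f g : etale_over_hom T1 T2) : f =1 g -> f = g.
Proof.
case: f g => [[f [[f1]]] f2 f3] [[g [[g1]]] g2 g3] /= /funext fg.
simpl in *; subst g.
rewrite -(Prop_irrelevance f1 g1) in g2 g3 *.
by rewrite (Prop_irrelevance f2 g2) (Prop_irrelevance f3 g3).
Qed.

Definition etale_over_id T : etale_over_hom T T :=
  @EtaleOverHom S T T idfun (fun=> erefl) (fun=> erefl).

Section Comp.
Variables (T1 T2 T3 : etale_over S).
Variables (g : etale_over_hom T2 T3) (f : etale_over_hom T1 T2).

Fact star_comp (t : T1) : (g \o f) (star t) = star ((g \o f) t).
Proof. by rewrite /= !over_map_star. Qed.

Fact projection_comp : projection T3 \o (g \o f) =1 projection T1.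
Proof.
move=> t.
exact: etrans (over_map_projection g (f t)) (over_map_projection f t).
Qed.

Definition etale_over_comp : etale_over_hom T1 T3 :=
  @EtaleOverHom S T1 T3 (g \o f) star_comp projection_comp.

End Comp.

Fact etale_over_comp1m T1 T2 (f : etale_over_hom T1 T2) :
  etale_over_comp (etale_over_id T2) f = f.
Proof. exact: etale_over_hom_eq. Qed.

Fact etale_over_compm1 T1 T2 (f : etale_over_hom T1 T2) :
  etale_over_comp f (etale_over_id T1) = f.
Proof. exact: etale_over_hom_eq. Qed.

Fact etale_over_compmA T1 T2 T3 T4 (h : etale_over_hom T3 T4)
    (g : etale_over_hom T2 T3) (f : etale_over_hom T1 T2) :
  etale_over_comp h (etale_over_comp g f) =
  etale_over_comp (etale_over_comp h g) f.
Proof. exact: etale_over_hom_eq. Qed.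

Definition etale_over_category : category :=
  Category etale_over_comp1m etale_over_compm1 etale_over_compmA.

End EtaleOver.

(* Main.v *)
Require Import Defs.
From HB Require Import structures.
From mathcomp Require Import all_boot.
From mathcomp Require Import boolp classical_sets functions.

Set Implicit Arguments.
Unset Strict Implicit.
Unset Printing Implicit Defensive.

Local Open Scope classical_set_scope.
Local Open Scope group_scope.

(** The two categories are linked by a pair of explicit functors.

    An etale action [X] gives the semigroup of pairs [(s, x)] with
    [sinv s * s = p x], where [(s, x)] stands for the arrow from [x] to
    [s . x].  The pairs multiply by
      [(s, x) (t, y) = (s t, (sinv (s t) * (s t)) . y)]:
    the right factor is restricted to the largest part of its domain on which
    [s t] is defined, and the point [x] of the left factor is forgotten, which
    is why the idempotents form a right normal band and not a left one.  The
    star reverses an arrow, [(s, x)* = (sinv s, s . x)], and the projection is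
    [(s, x) |-> s].  It is etale because an element of [S] in the left ideal of
    [p x] lifts to exactly one pair in the left ideal of [(p x, x)].

    An etale semigroup [theta : T -> S] gives an action on the idempotents of
    [T], anchored by [theta].  By etaleness, [s * theta e] has a unique lift
    [t] in [T e], the arrow with source [e] lying over [s * theta e], and
    [s . e] is its target [t * star t].  That this is an action rests on
    axiom (S3): if [v] lies in the left ideal of [u * star u] then [v * u] and
    [v] have the same target ([ranM]).

    Starting from [X], the idempotents of the pair semigroup are the
    [(p x, x)], a copy of [X] ([unit_natural]).  Starting from [T], an element
    [t] is determined by its value [theta t] and its source [star t * t],
    because it is the lift of [theta t] in [T (star t * t)]; these two
    coordinates identify [T] with the pair semigroup of its idempotents
    ([coord_natural]).  In both categories a bijective morphism is invertible,
    which leaves only the bijectivity of the two comparison maps to check. *)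

(** * Natural isomorphisms *)

Lemma naturally_isomorphic_sym (C D : category) (F G : functor C D) :
  naturally_isomorphic F G -> naturally_isomorphic G F.
Proof.
move=> [eta [eta_nat eta_iso]].
pose theta a := sval (cid (eta_iso a)).
exists theta; split=> [a b f|a]; rewrite /theta; last first.
  by case: cid => g [geta etag] /=; exists (eta a).
case: cid => h /= [theta_eta _]; case: cid => g /= [_ eta_theta].
rewrite -[LHS]compm1 -eta_theta compmA.
rewrite -[Defs.comp (Defs.comp _ _) (eta a)]compmA.
by rewrite -eta_nat !compmA theta_eta comp1m.
Qed.

(** * Inverse semigroups *)

Section InverseSemigroupTheory.
Variable S : inverseSemigroupType.
Implicit Types s t e f : S.

Lemma mulgVK s : s * sinv s * s = s.
Proof. by have [] := sinv_inverses s. Qed.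

Lemma mulVgV s : sinv s * s * sinv s = sinv s.
Proof. by have [] := sinv_inverses s. Qed.

Lemma sinvK s : sinv (sinv s) = s.
Proof. by apply/esym/sinv_unique; split; rewrite ?mulgVK ?mulVgV. Qed.

Lemma sinv_idem e : idempotents S e -> sinv e = e.
Proof. by move=> ee; apply/esym/sinv_unique; split; rewrite !ee. Qed.

Lemma mulVg_idem s : idempotents S (sinv s * s).
Proof. by rewrite /idempotents /= mulgA mulVgV. Qed.

(** If [x] is the inverse of [e * f] then so is [f * x * e].  By uniqueness
    [x = f * x * e], which makes [x] idempotent; hence [e * f], the inverse of
    [x], is [x] itself. *)
Lemma idemM e f :
  idempotents S e -> idempotents S f -> idempotents S (e * f).
Proof.
move=> ee ff; pose x := sinv (e * f).
have [efx xef] : inverses (e * f) x := sinv_inverses (e * f).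
have fxe : x = f * x * e.
  apply/esym/sinv_unique; split.
    by rewrite !mulgA -(mulgA e f f) ff -(mulgA _ e e) ee -(mulgA _ e f).
  rewrite !mulgA -(mulgA _ e e) ee -(mulgA _ f f) ff.
  by rewrite [in LHS]xef !mulgA.
have xx : idempotents S x.
  rewrite /idempotents /= {1 2}fxe !mulgA.
  have -> : f * x * e * f * x * e = f * (x * (e * f) * x) * e.
    by rewrite !mulgA.
  by rewrite -xef -fxe.
by rewrite -[e * f]sinvK -/x (sinv_idem xx).
Qed.

(** Once products of idempotents are idempotent, [e * f] is its own inverse, and
    [f * e] is another one. *)
Lemma idemC e f : idempotents S e -> idempotents S f -> e * f = f * e.
Proof.
move=> ee ff; have efef := idemM ee ff; have fefe := idemM ff ee.
rewrite -[LHS](sinv_idem efef); apply/esym/sinv_unique; split.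
  by rewrite !mulgA -(mulgA e f f) ff -(mulgA _ e e) ee -(mulgA _ e f) efef.
by rewrite !mulgA -(mulgA f e e) ee -(mulgA _ f f) ff -(mulgA _ f e) fefe.
Qed.

(** The two middle idempotents [t * sinv t] and [sinv s * s] have to be
    exchanged for the outer factors to cancel. *)
Lemma sinvM s t : sinv (s * t) = sinv t * sinv s.
Proof.
have tC : t * sinv t * (sinv s * s) = sinv s * s * (t * sinv t).
  apply: idemC; last exact: mulVg_idem.
  by rewrite -{1}(sinvK t); apply: mulVg_idem.
apply/esym/sinv_unique; split.
  transitivity (s * (t * sinv t * (sinv s * s)) * t); last by rewrite !mulgA.
  by rewrite tC !mulgA mulgVK -!mulgA (mulgA t) mulgVK.
transitivity (sinv t * (sinv s * s * (t * sinv t)) * sinv s).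
  by rewrite -tC !mulgA mulVgV -!mulgA (mulgA (sinv s)) mulVgV.
by rewrite !mulgA.
Qed.

End InverseSemigroupTheory.

(** * The semigroup of an etale action *)

Section ActionSemigroup.
Variables (S : inverseSemigroupType) (X : etale_action S).

Record action_pair := ActionPair {
  pair_elt : S;
  pair_pt : X;
  pair_anchor : sinv pair_elt * pair_elt = \val (anchor pair_pt)
}.

HB.instance Definition _ := gen_eqMixin action_pair.
HB.instance Definition _ := gen_choiceMixin action_pair.

Implicit Types a b c : action_pair.

Lemma action_pair_eq a b :
  pair_elt a = pair_elt b -> pair_pt a = pair_pt b -> a = b.
Proof.
case: a b => [s x sx] [t y ty] /= st xy; subst t y.
by rewrite (Prop_irrelevance sx ty).
Qed.

Lemma pair_elt_anchor a : pair_elt a * \val (anchor (pair_pt a)) = pair_elt a.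
Proof. by rewrite -pair_anchor mulgA mulgVK. Qed.

Lemma pair_act_anchor a :
  act (sinv (pair_elt a) * pair_elt a) (pair_pt a) = pair_pt a.
Proof. by rewrite pair_anchor act_anchor. Qed.

(** Restricting [x] to the domain of [s] turns [s] into the left part of a pair
    as soon as that domain lies below the anchor of [x].  This serves both to
    multiply pairs and to lift elements of [S]. *)
Fact pair_mul_anchor (s : S) (x : X) : s * \val (anchor x) = s ->
  sinv s * s = \val (anchor (act (sinv s * s) x)).
Proof.
move=> sx; rewrite anchor_act (sinv_idem (mulVg_idem s)).
by rewrite -(mulgA _ s) sx mulVg_idem.
Qed.

Fact pair_eltM_anchor a b :
  pair_elt a * pair_elt b * \val (anchor (pair_pt b)) = pair_elt a * pair_elt b.
Proof. by rewrite -mulgA pair_elt_anchor. Qed.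

Definition pair_mul a b : action_pair :=
  ActionPair (pair_mul_anchor (pair_eltM_anchor a b)).

Fact pair_mulA : associative pair_mul.
Proof.
move=> a b c; apply: action_pair_eq => /=; first exact: mulgA.
rewrite -actM; congr (act _ _).
rewrite -(mulgA (pair_elt a)); set u := pair_elt b * pair_elt c.
by rewrite -mulgA -(mulgA _ u) (mulgA u) mulgVK.
Qed.

HB.instance Definition _ := isSemigroup.Build action_pair pair_mulA.

Lemma pair_eltM a b : pair_elt (a * b) = pair_elt a * pair_elt b.
Proof. by []. Qed.

Lemma pair_ptM a b : pair_pt (a * b) =
  act (sinv (pair_elt a * pair_elt b) * (pair_elt a * pair_elt b)) (pair_pt b).
Proof. by []. Qed.

Fact idem_pair_anchor (x : X) :
  sinv (\val (anchor x)) * \val (anchor x) = \val (anchor x).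
Proof. by have e := set_valP (anchor x); rewrite (sinv_idem e). Qed.

(** The identity arrow at [x]; by [idem_pairK] every idempotent is one. *)
Definition idem_pair (x : X) : action_pair := ActionPair (idem_pair_anchor x).

Lemma idem_pair_idem x : idempotents action_pair (idem_pair x).
Proof.
have e := set_valP (anchor x).
apply: action_pair_eq; rewrite ?pair_ptM ?pair_eltM /=; first exact: e.
by rewrite e idem_pair_anchor act_anchor.
Qed.

Lemma idempotent_pairP a :
  idempotents action_pair a <-> idempotents S (pair_elt a).
Proof.
split=> [/(congr1 pair_elt) //|ee]; apply: action_pair_eq => //.
by rewrite pair_ptM ee pair_act_anchor.
Qed.

Lemma idem_pairK a :
  idempotents action_pair a -> idem_pair (pair_pt a) = a.
Proof.
move=> /idempotent_pairP ee; apply: action_pair_eq => //=.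
by rewrite -pair_anchor (sinv_idem ee) ee.
Qed.

Fact pair_star_anchor a : sinv (sinv (pair_elt a)) * sinv (pair_elt a) =
  \val (anchor (act (pair_elt a) (pair_pt a))).
Proof. by rewrite anchor_act pair_elt_anchor sinvK. Qed.

Definition pair_star a : action_pair := ActionPair (pair_star_anchor a).

Fact pair_starK : involutive pair_star.
Proof.
move=> a; apply: action_pair_eq => /=; first exact: sinvK.
by rewrite -actM pair_act_anchor.
Qed.

Lemma pair_starVK a : a * pair_star a * a = a.
Proof.
apply: action_pair_eq; rewrite ?pair_ptM !pair_eltM /= mulgVK //.
exact: pair_act_anchor.
Qed.

Fact pair_star_inverses a : inverses a (pair_star a).
Proof.
split; first by rewrite pair_starVK.
by have /= := pair_starVK (pair_star a); rewrite pair_starK => ->.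
Qed.

(** [a * star a] is the identity arrow at the target of [a]. *)
Lemma pair_mul_star a :
  a * pair_star a = idem_pair (act (pair_elt a) (pair_pt a)).
Proof.
rewrite -[LHS]idem_pairK; last first.
  by rewrite /idempotents /= mulgA pair_starVK.
rewrite pair_ptM /= -actM; congr (idem_pair (act _ _)).
have := mulVg_idem (sinv (pair_elt a)); rewrite sinvK => e.
by rewrite (sinv_idem e) (e : _ * _ = _) mulgVK.
Qed.

Fact pair_starM a b :
  pair_star (a * b) = pair_star b * pair_star (a * b * pair_star b).
Proof.
apply: action_pair_eq; rewrite ?pair_ptM /= ?pair_eltM /=.
  by rewrite !sinvM sinvK !mulgA mulVgV.
(* Both points are images of the point of [b]; it remains to compare the
   elements of [S] that act on it, using [u * t = s * t]. *)
set s := pair_elt a; set t := pair_elt b; set u := s * t * sinv t.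
have ut : u * t = s * t by rewrite /u -!mulgA (mulgA t) mulgVK.
rewrite -!actM; congr (act _ _).
rewrite -sinvM ut sinvK -(mulgA _ u) (mulgA u) mulgVK.
by rewrite -(mulgA _ u) ut mulgA.
Qed.

Fact pair_star_idempotent e : idempotents action_pair e -> pair_star e = e.
Proof.
move=> /idempotent_pairP ee; apply: action_pair_eq => /=.
  exact: sinv_idem.
by rewrite -[RHS]pair_act_anchor (sinv_idem ee) ee.
Qed.

Fact action_pair_nonempty : [set: action_pair] !=set0.
Proof. by have [x _] := carrier_nonempty X; exists (idem_pair x). Qed.

Fact action_pair_regular : regular action_pair.
Proof. by move=> a; exists (pair_star a); apply: pair_star_inverses. Qed.

(** The product of three pairs sees only the [S]-parts of the first two, so the
    commutation of idempotents of [S] exchanges them; it cannot exchange the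
    last one, whose point survives. *)
Fact action_pair_right_normal_band :
  right_normal_band (idempotents action_pair).
Proof.
split=> [e f /idempotent_pairP ee /idempotent_pairP ff|//|e f g].
  by apply/idempotent_pairP; exact: idemM.
move=> /idempotent_pairP ee /idempotent_pairP ff _.
by apply: action_pair_eq; rewrite ?pair_ptM !pair_eltM (idemC ee ff).
Qed.

HB.instance Definition _ := isNonempty.Build action_pair action_pair_nonempty.
HB.instance Definition _ := Semigroup_isRightGenInverse.Build action_pair
  action_pair_regular action_pair_right_normal_band.
HB.instance Definition _ := Semigroup_isStar.Build action_pair
  pair_starK pair_star_inverses pair_starM pair_star_idempotent.

HB.instance Definition _ :=
  isMultiplicative.Build action_pair S pair_elt pair_eltM.

Fact pair_elt_etale : etale pair_elt.
Proof.
move=> e ee; split.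
- by move=> _ [a _ <-]; exists (pair_elt a) .
- move=> _ _ /set_mem [a _ <-] /set_mem [b _ <-] ab.
  have {}ab : pair_elt a * pair_elt e = pair_elt b * pair_elt e := ab.
  by apply: action_pair_eq => //; rewrite !pair_ptM ab.
move=> _ [s _ <-].
have se : s * pair_elt e * \val (anchor (pair_pt e)) = s * pair_elt e.
  by rewrite -mulgA pair_elt_anchor.
exists (ActionPair (pair_mul_anchor se)) => //.
exists (ActionPair (pair_mul_anchor se)) => //.
have see : s * pair_elt e * pair_elt e = s * pair_elt e.
  by rewrite -mulgA -pair_eltM ee.
by apply: action_pair_eq; rewrite ?pair_ptM ?pair_eltM /= see.
Qed.

Definition action_semigroup : etale_over S := EtaleOver pair_elt_etale.

End ActionSemigroup.

Arguments action_pair {S} X.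
Arguments action_semigroup {S} X.

Section ActionSemigroupMap.
Variables (S : inverseSemigroupType) (X Y : etale_action S).
Variable f : etale_action_hom X Y.

Fact pair_map_anchor (a : action_pair X) :
  sinv (pair_elt a) * pair_elt a = \val (anchor (f (pair_pt a))).
Proof. by rewrite anchor_action_map pair_anchor. Qed.

Definition pair_map (a : action_pair X) : action_pair Y :=
  ActionPair (pair_map_anchor a).

Fact pair_mapM : {morph pair_map : a b / a * b}.
Proof.
by move=> a b; apply: action_pair_eq => //=; exact: act_action_map.
Qed.

HB.instance Definition _ :=
  isMultiplicative.Build (action_pair X) (action_pair Y) pair_map pair_mapM.

Fact pair_map_star (a : action_pair X) : pair_map (star a) = star (pair_map a).
Proof. by apply: action_pair_eq => //=; exact: act_action_map. Qed.

Definition action_semigroup_map :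
    etale_over_hom (action_semigroup X) (action_semigroup Y) :=
  @EtaleOverHom S (action_semigroup X) (action_semigroup Y) pair_map
    pair_map_star (fun=> erefl).

End ActionSemigroupMap.

Section ActionSemigroupFunctor.
Variable S : inverseSemigroupType.

Fact action_semigroup_map1 (X : etale_action S) :
  action_semigroup_map (etale_action_id X) =
  etale_over_id (action_semigroup X).
Proof. by apply: etale_over_hom_eq => a; exact: action_pair_eq. Qed.

Fact action_semigroup_mapM (X Y Z : etale_action S)
    (g : etale_action_hom Y Z) (f : etale_action_hom X Y) :
  action_semigroup_map (etale_action_comp g f) =
  etale_over_comp (action_semigroup_map g) (action_semigroup_map f).
Proof. by apply: etale_over_hom_eq => a; exact: action_pair_eq. Qed.

Definition action_semigroup_functor :
    functor (classifying_space S) (etale_over_category S) :=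
  @Functor (classifying_space S) (etale_over_category S)
    action_semigroup (@action_semigroup_map S)
    action_semigroup_map1 action_semigroup_mapM.

End ActionSemigroupFunctor.

(** * The action on the idempotents of a semigroup over S *)

Section IdempotentAction.
Variables (S : inverseSemigroupType) (T : etale_over S).
Implicit Types (s : S) (t u : T) (e : idempotents T).

Local Notation theta := (projection T).

(** Homomorphisms preserve inverses, and [S] has only one for each element. *)
Lemma projection_star t : theta (star t) = sinv (theta t).
Proof.
have [tst sts] := star_inverses t.
by apply: sinv_unique; split; rewrite -!gmulfM -?tst -?sts.
Qed.

Lemma projection_idem t : idempotents T t -> idempotents S (theta t).
Proof. by rewrite /idempotents /= -gmulfM => ->. Qed.

Lemma left_ideal_idemE t e : left_ideal_of (\val e) t <-> t * \val e = t.
Proof.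
split=> [[u _ <-]|te]; last by exists t.
by rewrite -mulgA (set_valP e : _ * _ = _).
Qed.

Lemma lift_unique e t u :
  t * \val e = t -> u * \val e = u -> theta t = theta u -> t = u.
Proof.
move=> /left_ideal_idemE te /left_ideal_idemE ue.
by have [_ inj _] := projection_etale (set_valP e); apply: inj; exact: mem_set.
Qed.

Lemma lift_exists s e :
  exists t : T, t * \val e = t /\ theta t = s * theta (\val e).
Proof.
have [_ _ surj] := projection_etale (set_valP e).
have [|t /left_ideal_idemE te ts] := surj (s * theta (\val e)).
  by exists s.
by exists t.
Qed.

Definition lift s e : T := sval (cid (lift_exists s e)).

Lemma lift_mulr s e : lift s e * \val e = lift s e.
Proof. by rewrite /lift; case: cid => t []. Qed.

Lemma projection_lift s e : theta (lift s e) = s * theta (\val e).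
Proof. by rewrite /lift; case: cid => t []. Qed.

Lemma liftE s e t :
  t * \val e = t -> theta t = s * theta (\val e) -> lift s e = t.
Proof.
move=> te ts; apply: (@lift_unique e) => //; first exact: lift_mulr.
by rewrite projection_lift.
Qed.

Lemma mul_star_idem t : idempotents T (t * star t).
Proof.
have [tst _] := star_inverses t.
by rewrite /idempotents /= mulgA -tst.
Qed.

Lemma star_mul_idem t : idempotents T (star t * t).
Proof. by have := mul_star_idem (star t); rewrite starK. Qed.

(** The target and the source of [t], viewed as an arrow between idempotents. *)
Definition ran t : idempotents T :=
  exist _ (t * star t) (mem_set (mul_star_idem t)).
Definition dom t : idempotents T :=
  exist _ (star t * t) (mem_set (star_mul_idem t)).

Lemma mul_dom t : t * \val (dom t) = t.
Proof. by have [tst _] := star_inverses t; rewrite /= mulgA -tst. Qed.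

Lemma ran_mul t : \val (ran t) * t = t.
Proof. by have [tst _] := star_inverses t; rewrite /= -tst. Qed.

Lemma ran_idem e : ran (\val e) = e.
Proof.
apply: val_inj => /=; have ee := set_valP e.
by rewrite (star_idempotent _ ee) (ee : _ * _ = _).
Qed.

(** The target of a composite of arrows is that of the arrow applied last, here
    [u], whose source lies below the target of [t].  Axiom (S3)
    rewrites [star (u * t)] as [star t * star (u * (t * star t))], which is
    [star t * star u]. *)
Lemma ranM u t : u * \val (ran t) = u -> ran (u * t) = ran u.
Proof.
move=> /= ut; apply: val_inj => /=.
by rewrite starM -(mulgA u t (star t)) ut !mulgA -(mulgA u t) ut.
Qed.

Definition idem_anchor e : idempotents S :=
  exist _ (theta (\val e)) (mem_set (projection_idem (set_valP e))).

(** Transport of [e] along the arrow over [s * theta e] with source [e]. *)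
Definition idem_act s e : idempotents T := ran (lift s e).

(** The lift of [s * s'] at [e] factors through the lift of [s'] at [e],
    followed by the lift of [s] at the target of the latter. *)
Fact idem_actM s s' e : idem_act (s * s') e = idem_act s (idem_act s' e).
Proof.
set f := idem_act s' e; rewrite /idem_act.
rewrite -(@ranM (lift s f) (lift s' e)); last exact: lift_mulr.
congr ran; apply: liftE; first by rewrite -mulgA lift_mulr.
have -> : theta (lift s f * lift s' e) = theta (lift s f) * theta (lift s' e).
  exact: gmulfM.
rewrite projection_lift -(mulgA s) -[theta (\val f) * _]gmulfM ran_mul.
by rewrite projection_lift mulgA.
Qed.

Fact idem_act_anchor e : idem_act (\val (idem_anchor e)) e = e.
Proof.
have ee : \val e * \val e = \val e := set_valP e.
rewrite /idem_act (liftE (t := \val e)) ?ran_idem //=.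
by rewrite -gmulfM ee.
Qed.

Fact idem_anchor_act s e :
  \val (idem_anchor (idem_act s e)) = s * \val (idem_anchor e) * sinv s.
Proof.
have ee := projection_idem (set_valP e).
rewrite /= gmulfM projection_star projection_lift sinvM (sinv_idem ee).
by rewrite !mulgA -(mulgA s) (ee : _ * _ = _).
Qed.

Fact idem_nonempty : [set: idempotents T] !=set0.
Proof. by have [t _] := @Defs.nonempty T; exists (ran t). Qed.

Definition idempotent_action : etale_action S :=
  EtaleAction idem_nonempty idem_actM idem_act_anchor idem_anchor_act.

End IdempotentAction.

Arguments idempotent_action {S} T.

Section IdempotentActionMap.
Variables (S : inverseSemigroupType) (T1 T2 : etale_over S).
Variable h : etale_over_hom T1 T2.

Lemma over_map_idem (e : T1) : idempotents T1 e -> idempotents T2 (h e).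
Proof. by rewrite /idempotents /= -gmulfM => ->. Qed.

Definition idem_map (e : idempotents T1) : idempotents T2 :=
  exist _ (h (\val e)) (mem_set (over_map_idem (set_valP e))).

Fact idem_map_anchor (e : idempotents T1) :
  idem_anchor (idem_map e) = idem_anchor e.
Proof. by apply: val_inj => /=; exact: over_map_projection. Qed.

Lemma idem_map_ran (t : T1) : idem_map (ran t) = ran (h t).
Proof. by apply: val_inj; rewrite /= gmulfM over_map_star. Qed.

Fact idem_map_act (s : S) (e : idempotents T1) :
  idem_map (idem_act s e) = idem_act s (idem_map e).
Proof.
rewrite /idem_act idem_map_ran; congr ran; apply/esym/liftE => /=.
  by rewrite -gmulfM lift_mulr.
have hP t : projection T2 (h t) = projection T1 t := over_map_projection h t.
by rewrite !hP projection_lift.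
Qed.

Definition idempotent_action_map :
    etale_action_hom (idempotent_action T1) (idempotent_action T2) :=
  @EtaleActionHom S (idempotent_action T1) (idempotent_action T2) idem_map
    idem_map_anchor idem_map_act.

End IdempotentActionMap.

Section IdempotentActionFunctor.
Variable S : inverseSemigroupType.

Fact idempotent_action_map1 (T : etale_over S) :
  idempotent_action_map (etale_over_id T) =
  etale_action_id (idempotent_action T).
Proof. by apply: etale_action_hom_eq => e; exact: val_inj. Qed.

Fact idempotent_action_mapM (T1 T2 T3 : etale_over S)
    (g : etale_over_hom T2 T3) (f : etale_over_hom T1 T2) :
  idempotent_action_map (etale_over_comp g f) =
  etale_action_comp (idempotent_action_map g) (idempotent_action_map f).
Proof. by apply: etale_action_hom_eq => e; exact: val_inj. Qed.

Definition idempotent_action_functor :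
    functor (etale_over_category S) (classifying_space S) :=
  @Functor (etale_over_category S) (classifying_space S)
    idempotent_action (@idempotent_action_map S)
    idempotent_action_map1 idempotent_action_mapM.

End IdempotentActionFunctor.

(** * Invertible morphisms *)

Section BijectiveMorphisms.
Variable S : inverseSemigroupType.

Lemma bijective_action_hom (X Y : etale_action S) (f : etale_action_hom X Y) :
  bijective f -> isomorphism (f : @hom (classifying_space S) X Y).
Proof.
move=> [g fK gK].
have gp y : anchor (g y) = anchor y by rewrite -{2}(gK y) anchor_action_map.
have ga s y : g (act s y) = act s (g y).
  by rewrite -{1}(gK y) -act_action_map fK.
exists (EtaleActionHom gp ga).
by split; apply: etale_action_hom_eq.
Qed.

Lemma bijective_over_hom (T1 T2 : etale_over S) (f : etale_over_hom T1 T2) :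
  bijective f -> isomorphism (f : @hom (etale_over_category S) T1 T2).
Proof.
move=> [g fK gK].
have gM : {morph g : a b / a * b}.
  by move=> a b; rewrite -{1}(gK a) -{1}(gK b) -gmulfM fK.
pose gm : {multiplicative T2 -> T1} :=
  HB.pack g (isMultiplicative.Build _ _ g gM).
have gs t : gm (star t) = star (gm t).
  by rewrite /gm /= -{1}(gK t) -over_map_star fK.
have gp : projection T1 \o gm =1 projection T2.
  by move=> t; rewrite /= -(over_map_projection f) /= gK.
exists (EtaleOverHom gs gp).
by split; apply: etale_over_hom_eq.
Qed.

End BijectiveMorphisms.

(** * Recovering an action and a semigroup *)

Section Unit.
Variable S : inverseSemigroupType.

Section Component.
Variable X : etale_action S.
Local Notation IX := (idempotent_action (action_semigroup X)).

Definition unit_map (x : X) : IX :=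
  exist _ (idem_pair x) (mem_set (idem_pair_idem x)).

Fact unit_map_anchor x : anchor (unit_map x) = anchor x.
Proof. exact: val_inj. Qed.

(** The pair over [s * p x] obtained by restricting [x] is the lift of [s] at
    the identity arrow of [x], and its target is [s . x]. *)
Fact unit_map_act (s : S) x : unit_map (act s x) = act s (unit_map x).
Proof.
have se : s * \val (anchor x) * \val (anchor x) = s * \val (anchor x).
  by rewrite -mulgA (set_valP (anchor x) : _ * _ = _).
pose a := ActionPair (pair_mul_anchor se).
have liftx : lift s (unit_map x) = a :> action_semigroup X.
  apply: liftE => //.
  by apply: action_pair_eq; rewrite ?pair_ptM ?pair_eltM /= se.
apply: val_inj; rewrite /= /idem_act liftx /= pair_mul_star /=.
by rewrite -actM mulgA mulgVK actM act_anchor.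
Qed.

Definition unit_hom : etale_action_hom X IX :=
  @EtaleActionHom S X IX unit_map unit_map_anchor unit_map_act.

Lemma unit_bij : bijective unit_hom.
Proof.
exists (fun e : IX => pair_pt (\val e)) => [//|e].
by apply: val_inj; apply: idem_pairK; exact: set_valP e.
Qed.

End Component.

Lemma unit_natural : naturally_isomorphic (functor_id (classifying_space S))
  (functor_comp (idempotent_action_functor S) (action_semigroup_functor S)).
Proof.
exists unit_hom; split=> [X Y f|X].
  apply: etale_action_hom_eq => x; apply: val_inj.
  by apply: action_pair_eq; rewrite /= ?anchor_action_map.
exact: bijective_action_hom (unit_bij X).
Qed.

End Unit.

Section Coordinates.
Variable S : inverseSemigroupType.

Section Component.
Variable T : etale_over S.
Local Notation theta := (projection T).
Local Notation PT := (action_pair (idempotent_action T)).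

Fact coord_anchor (t : T) : sinv (theta t) * theta t = theta (\val (dom t)).
Proof. by rewrite /= gmulfM projection_star. Qed.

Definition coord_map (t : T) : PT :=
  @ActionPair S (idempotent_action T) (theta t) (dom t) (coord_anchor t).

(** The second coordinates agree because [dom (a * b)], which is an idempotent,
    is itself the lift of its image in [S] at [dom b], hence its own target. *)
Fact coord_mapM : {morph coord_map : a b / a * b}.
Proof.
move=> a b; apply: action_pair_eq; rewrite ?pair_ptM /=; first exact: gmulfM.
have ab : a * b * \val (dom b) = a * b by rewrite -mulgA mul_dom.
rewrite /idem_act (liftE (t := \val (dom (a * b)))) ?ran_idem //=.
  by rewrite -mulgA [in LHS]ab.
have -> : theta (star (a * b) * (a * b))
    = sinv (theta a * theta b) * (theta a * theta b).
  by rewrite gmulfM projection_star gmulfM.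
rewrite -coord_anchor -(mulgA _ (theta a * theta b)) -(mulgA (theta a)).
by rewrite (mulgA (theta b)) mulgVK.
Qed.

HB.instance Definition _ := isMultiplicative.Build T PT coord_map coord_mapM.

Fact coord_map_star (t : T) : coord_map (star t) = star (coord_map t).
Proof.
apply: action_pair_eq => /=; first exact: projection_star.
rewrite /idem_act (liftE (t := t)); last first.
- by rewrite -coord_anchor mulgA mulgVK.
- exact: mul_dom.
by apply: val_inj; rewrite /= starK.
Qed.

Definition coord_hom :
    etale_over_hom T (action_semigroup (idempotent_action T)) :=
  @EtaleOverHom S T (action_semigroup (idempotent_action T)) coord_map
    coord_map_star (fun=> erefl).

(** Each [t] is the only lift of its value in [S] at its source, and the source
    of a lift at [e] over a pair [(s, e)] is [e] itself. *)
Lemma coord_bij : bijective coord_hom.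
Proof.
exists (fun a : PT => lift (pair_elt a) (pair_pt a)) => [t|a].
  apply: liftE => /=; first exact: mul_dom.
  by rewrite -coord_anchor mulgA mulgVK.
have elta : theta (lift (pair_elt a) (pair_pt a)) = pair_elt a.
  by rewrite projection_lift; exact: pair_elt_anchor.
apply: action_pair_eq => //=; apply: val_inj.
apply: (@lift_unique S T (pair_pt a)).
- by rewrite /= -mulgA lift_mulr.
- exact: (set_valP (pair_pt a)).
by rewrite -coord_anchor elta pair_anchor.
Qed.

End Component.

Lemma coord_natural : naturally_isomorphic (functor_id (etale_over_category S))
  (functor_comp (action_semigroup_functor S) (idempotent_action_functor S)).
Proof.
exists coord_hom; split=> [T1 T2 f|T].
  apply: etale_over_hom_eq => t; apply: action_pair_eq => /=.
    exact: over_map_projection.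
  by apply: val_inj; rewrite /= gmulfM over_map_star.
exact: bijective_over_hom (coord_bij T).
Qed.

End Coordinates.

Theorem theorem1p1 (S : inverseSemigroupType) :
  equivalent_categories (classifying_space S) (etale_over_category S).
Proof.
exists (action_semigroup_functor S), (idempotent_action_functor S).
by split; apply: naturally_isomorphic_sym;
  [exact: unit_natural | exact: coord_natural].
Qed.
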